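(* Let $S=\{(d_0,q_0),\ldots,(d_M,q_M)\}$ be a regular alphabet--base system, with associated sequences $\alpha^j$ ($0\le j\le M-1$), $\gamma^j$ ($1\le j\le M$) and set of unique expansions $\mathcal U_S'$, and let $\alpha_{GR},\alpha_{KL}\in\{0,\ldots,M\}^{\mathbb N}$ be the sequences defined in the context. (i) If $\alpha^j\preceq\alpha_{GR}$ and $\gamma^{M-j}\succeq\overline{\alpha_{GR}}$ for all $0\le j<M$, then $\mathcal U_S'=\{0^\infty,M^\infty\}$. (ii) If $\alpha^j\succ\alpha_{GR}$ and $\gamma^{M-j}\prec\overline{\alpha_{GR}}$ for all $0\le j<M$, then $\mathcal U_S'$ is an infinite set. (iii) If $\alpha^j\prec\alpha_{KL}$ and $\gamma^{M-j}\succ\overline{\alpha_{KL}}$ for all $0\le j<M$, then $\mathcal U_S'$ is countable (finite or countably infinite). (iv) If $\alpha^j\succeq\alpha_{KL}$ and $\gamma^{M-j}\preceq\overline{\alpha_{KL}}$ for all $0\le j<M$, then $\mathcal U_S'$ has the power of the continuum.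
   Context: Let $M\ge 1$ be an integer. An alphabet--base system is a finite indexed family $S=\{(d_0,q_0),\ldots,(d_M,q_M)\}$ of pairs of real numbers with $q_0,\ldots,q_M>1$. A sequence is an element $(j_i)=j_1j_2\cdots$ of $\{0,\ldots,M\}^{\mathbb N}$, $\mathbb N=\{1,2,\ldots\}$. For a sequence put $\pi((j_i))=\sum_{i=1}^{\infty}\frac{d_{j_i}}{q_{j_1}\cdots q_{j_i}}$ (this series always converges). A sequence $(j_i)$ is an expansion of $x\in\mathbb R$ if $\pi((j_i))=x$. Write $j^\infty$ for the constant sequence $jj\cdots$, and $w^\infty$ for the infinite repetition of a finite word $w$. Then $\pi(j^\infty)=\frac{d_j}{q_j-1}$; set $\lambda:=\min_j\pi(j^\infty)$, $\Lambda:=\max_j\pi(j^\infty)$. $S$ is regular if $\frac{d_0+\lambda}{q_0}<\frac{d_1+\lambda}{q_1}<\cdots<\frac{d_M+\lambda}{q_M}$, $\frac{d_0+\Lambda}{q_0}<\frac{d_1+\Lambda}{q_1}<\cdots<\frac{d_M+\Lambda}{q_M}$, and $\frac{d_j+\Lambda}{q_j}\ge\frac{d_{j+1}+\lambda}{q_{j+1}}$ for all $j<M$. Sequences are ordered lexicographically: $(j_i)\prec(k_i)$ if there is an index $n$ with $j_i=k_i$ for all $i<n$ and $j_n<k_n$; $\preceq$ means $\prec$ or $=$. A sequence is finite if it has a last nonzero element $j_n>0$, and infinite otherwise (so $0^\infty$ is infinite). A sequence is co-finite if it has a last element $j_n<M$, and co-infinite otherwise (so $M^\infty$ is co-infinite).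 The reflection of a sequence is $\overline{(j_i)}:=(M-j_i)$. For regular $S$ and $x\in[\lambda,\Lambda]$, $a(x)$ denotes the lexicographically largest infinite expansion of $x$ and $m(x)$ the lexicographically smallest co-infinite expansion of $x$ (both exist). Define $\alpha^j:=a\left(q_j\left(\frac{d_{j+1}+\lambda}{q_{j+1}}-\frac{d_j}{q_j}\right)\right)$ for $j=0,\ldots,M-1$, and $\gamma^j:=m\left(q_j\left(\frac{d_{j-1}+\Lambda}{q_{j-1}}-\frac{d_j}{q_j}\right)\right)$ for $j=1,\ldots,M$; the arguments lie in $[\lambda,\Lambda]$ when $S$ is regular. $\mathcal U_S$ is the set of $x\in[\lambda,\Lambda]$ having exactly one expansion, and $\mathcal U_S'$ is the set of the corresponding expansions (sequences). Special sequences: $\alpha_{GR}:=(k(k-1))^\infty$ (period two, digits $k,k-1$) if $M=2k-1$, and $\alpha_{GR}:=k^\infty$ if $M=2k$. Let $(\tau_i)_{i\ge 0}$ be the Thue--Morse sequence, $\tau_i\in\{0,1\}$ being the parity of the number of ones in the binary expansion of $i$ (so $\tau_0=0$ and $\tau_1\tau_2\cdots=1101\,0011\cdots$). Then $\alpha_{KL}:=(k-1+\tau_i)_{i\ge1}$ if $M=2k-1$, and $\alpha_{KL}:=(k+\tau_i-\tau_{i-1})_{i\ge1}$ if $M=2k$. *)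

(* Defs.v *)
From HB Require Import structures.
From mathcomp Require Import all_boot all_order all_algebra.
From mathcomp Require Import all_classical all_reals all_analysis.
Set Implicit Arguments.
Unset Strict Implicit.
Unset Printing Implicit Defensive.
Import Order.TTheory GRing.Theory Num.Theory.
Import numFieldNormedType.Exports.
Local Open Scope classical_set_scope.
Local Open Scope ring_scope.

Record alphabet_base (R : realType) (M : nat) := AlphabetBase {
  dig : 'I_M.+1 -> R;
  base : 'I_M.+1 -> R;
  base_gt1 : forall j, 1 < base j }.

(* Sequences are indexed from 0: [s i] is the digit written j_{i+1} when
   sequences are indexed by {1, 2, ...}. *)
Definition dseq (M : nat) := nat -> 'I_M.+1.

Section Sequences.
Context {M : nat}.
Implicit Types s t : dseq M.

Definition cseq (j : 'I_M.+1) : dseq M := fun=> j.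

Definition lexlt s t : Prop :=
  exists n, (forall i, (i < n)%N -> s i = t i) /\ (s n < t n)%N.

Definition lexle s t : Prop := lexlt s t \/ s = t.

Definition fin_seq s : Prop :=
  exists n, (0 < s n)%N /\ forall i, (n < i)%N -> s i = ord0.

Definition cofin_seq s : Prop :=
  exists n, (s n < M)%N /\ forall i, (n < i)%N -> s i = ord_max.

Definition reflect_seq s : dseq M := fun i => rev_ord (s i).

End Sequences.

Section System.
Context {R : realType} {M : nat} (S : alphabet_base R M).
Implicit Types (s t : dseq M) (x : R).

Definition pi_val s : R :=
  limn (series (fun i => dig S (s i) / \prod_(k < i.+1) base S (s k))).

Definition expansion x s : Prop := pi_val s = x.

Definition lambda : R :=
  \big[Num.min/pi_val (cseq ord0)]_(j < M.+1) pi_val (cseq j).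

Definition Lambda : R :=
  \big[Num.max/pi_val (cseq ord0)]_(j < M.+1) pi_val (cseq j).

Definition regular : Prop :=
  forall i j : 'I_M.+1, j = i.+1 :> nat ->
  [/\ (dig S i + lambda) / base S i < (dig S j + lambda) / base S j,
      (dig S i + Lambda) / base S i < (dig S j + Lambda) / base S j
    & (dig S i + Lambda) / base S i >= (dig S j + lambda) / base S j].

Definition largest_infinite_expansion x s : Prop :=
  [/\ expansion x s, ~ fin_seq s
    & forall t, expansion x t -> ~ fin_seq t -> lexle t s].

Definition smallest_coinfinite_expansion x s : Prop :=
  [/\ expansion x s, ~ cofin_seq s
    & forall t, expansion x t -> ~ cofin_seq t -> lexle s t].

(* The default value of [xget] is irrelevant when S is regular and
   lambda <= x <= Lambda, since the extremal expansion then exists (and it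
   is unique because the lexicographic order is total). *)
Definition a_exp x : dseq M :=
  xget (cseq ord0) [set s | largest_infinite_expansion x s].

Definition m_exp x : dseq M :=
  xget (cseq ord0) [set s | smallest_coinfinite_expansion x s].

(* [inord j] is the element of 'I_M.+1 of value j as soon as j <= M; hence
   [alpha j] is meaningful for j < M and [gamma j] for 1 <= j <= M. *)
Definition alpha (j : nat) : dseq M :=
  a_exp (base S (inord j) *
         ((dig S (inord j.+1) + lambda) / base S (inord j.+1)
          - dig S (inord j) / base S (inord j))).

Definition gamma (j : nat) : dseq M :=
  m_exp (base S (inord j) *
         ((dig S (inord j.-1) + Lambda) / base S (inord j.-1)
          - dig S (inord j) / base S (inord j))).

Definition univoque : set R :=
  [set x | lambda <= x <= Lambda /\ exists! s, expansion x s].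

Definition univoque_seq : set (dseq M) := [set s | univoque (pi_val s)].

End System.

(* M = 2k - 1 with k = M.+1./2 when M is odd, M = 2k with k = M./2 otherwise. *)
Definition alphaGR (M : nat) : dseq M := fun i =>
  if odd M then let k := M.+1./2 in inord (if odd i then k.-1 else k)
  else inord M./2.

(* The bits of i of rank >= i vanish because i < 2 ^ i. *)
Definition thue_morse (i : nat) : bool :=
  odd (\sum_(k < i) odd (i %/ 2 ^ k))%N.

(* For M even and positive, k > 0 and the subtraction is not truncated. *)
Definition alphaKL (M : nat) : dseq M := fun i =>
  if odd M then let k := M.+1./2 in inord (k.-1 + thue_morse i.+1)%N
  else let k := M./2 in inord (k + thue_morse i.+1 - thue_morse i)%N.

(* Main.v *)
(** Write [f_j y = (d_j + y) / q_j], so that [pi_val s = f_(s 0) (pi_val s')] with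
    [s'] the tail of [s].  Reflecting digits and values exchanges the systems [S]
    and [reflect_sys S], maps the sequences [gamma] of one to the sequences
    [alpha] of the other, and so reduces every statement about lower bounds to
    one about upper bounds.

    A sequence is a unique expansion iff each tail following a digit [j < M] is
    smaller than [alpha j], and the reflected condition holds.  In one direction,
    [alpha j] is the quasi-greedy expansion of the preimage of [f_(j+1) lambda]
    under [f_j]; in the other, the excess of a tail over that bound would have to
    grow geometrically.

    For [alphaGR] the fact that its first tail is its reflection
    leaves only the two constant sequences below the threshold, while the
    sequences [0^n alphaGR] lie weakly below it.  Strictly below [alphaKL], the
    self-similarity of the prefixes of length [2^n] forces eventual periodicity.
    At [alphaKL], the map [x -> theta (0 b x)], with [theta] the Thue--Morse
    morphism and [b] a free bit, preserves the admissible binary sequences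
    starting with [01]; iterating it embeds [nat -> bool]. *)
Require Import Defs.
From mathcomp Require Import all_boot all_order all_algebra.
From mathcomp Require Import all_classical all_reals all_analysis.
From mathcomp Require Import zify ring lra.
Import Order.TTheory GRing.Theory Num.Theory.
Import numFieldNormedType.Exports.
Set Implicit Arguments.
Unset Strict Implicit.
Unset Printing Implicit Defensive.
Local Open Scope classical_set_scope.
Local Open Scope ring_scope.

(** * Lexicographic order *)

Definition shift {T : Type} (n : nat) (s : nat -> T) : nat -> T :=
  fun i => s (i + n)%N.

Lemma shiftD {T : Type} m n (s : nat -> T) :
  shift m (shift n s) = shift (m + n) s.
Proof. by apply/funext => i; rewrite /shift addnA. Qed.

Lemma shift0 {T : Type} (s : nat -> T) : shift 0 s = s.
Proof. by apply/funext => i; rewrite /shift addn0. Qed.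

Section Lex.
Context {M : nat}.
Implicit Types s t u : dseq M.

Lemma reflect_seqK : involutive (@reflect_seq M).
Proof. by move=> s; apply/funext => i; apply: rev_ordK. Qed.

Lemma reflect_seqE s i : reflect_seq s i = (M - s i)%N :> nat.
Proof. by rewrite /= subSS. Qed.

Lemma reflect_cseq j : reflect_seq (cseq j) = cseq (rev_ord j) :> dseq M.
Proof. by []. Qed.

Lemma rev_ord0 : rev_ord ord0 = ord_max :> 'I_M.+1.
Proof. by apply: val_inj; rewrite /= subn1. Qed.

Lemma rev_ord_max : rev_ord ord_max = ord0 :> 'I_M.+1.
Proof. by apply: val_inj; rewrite /= subnn. Qed.

Lemma reflect_shift n s : reflect_seq (shift n s) = shift n (reflect_seq s).
Proof. by []. Qed.

Lemma neq_first_diff s t : s <> t ->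
  exists n, (forall i, (i < n)%N -> s i = t i) /\ s n != t n.
Proof.
move=> nst; have exn : exists n, s n != t n.
  apply: contrapT => /forallNP h; apply: nst; apply/funext => n.
  by have /negP := h n; rewrite negbK => /eqP.
case: (ex_minnP exn) => n snt nmin; exists n; split => // i ltin.
by apply/eqP/negPn/negP => /nmin; rewrite leqNgt ltin.
Qed.

Lemma lex_total s t : [\/ s = t, lexlt s t | lexlt t s].
Proof.
have [->|/neq_first_diff [n [e]]] := pselect (s = t); first by constructor 1.
rewrite neq_ltn => /orP[h|h]; first by constructor 2; exists n.
by constructor 3; exists n; split => // i /e.
Qed.

Lemma lexlt_irr s : ~ lexlt s s.
Proof. by case=> n [_]; rewrite ltnn. Qed.

Lemma lexlt_trans t s u : lexlt s t -> lexlt t u -> lexlt s u.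
Proof.
move=> [m [em lm]] [n [en ln]]; case: (ltngtP m n) => [lt|lt|e].
- exists m; split; last by rewrite -en.
  by move=> i im; rewrite em // en // (ltn_trans im).
- exists n; split; last by rewrite em.
  by move=> i im; rewrite em ?en // (ltn_trans im).
- subst n; exists m; split; last exact: ltn_trans ln.
  by move=> i im; rewrite em ?en.
Qed.

Lemma lexle_lt_trans t s u : lexle s t -> lexlt t u -> lexlt s u.
Proof. by move=> [/lexlt_trans h /h|->]. Qed.

Lemma lexlt_le_trans t s u : lexlt s t -> lexle t u -> lexlt s u.
Proof. by move=> h [/(lexlt_trans h)|<-]. Qed.

Lemma lexlt_asym s t : lexlt s t -> ~ lexlt t s.
Proof. by move=> st ts; apply: (lexlt_irr (lexlt_trans st ts)). Qed.

Lemma lexle_anti s t : lexle s t -> lexle t s -> s = t.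
Proof. by move=> [h /(lexlt_le_trans h)/lexlt_irr|]. Qed.

Lemma lexlt_reflect s t :
  lexlt (reflect_seq s) (reflect_seq t) <-> lexlt t s.
Proof.
split=> -[n [e l]]; exists n; split.
- by move=> i /e /rev_ord_inj.
- by move: l; rewrite !reflect_seqE; have := ltn_ord (s n); lia.
- by move=> i /e h; rewrite /reflect_seq h.
- by rewrite !reflect_seqE; have := ltn_ord (s n); lia.
Qed.

Lemma lexlt_reflectl s t : lexlt (reflect_seq s) t <-> lexlt (reflect_seq t) s.
Proof. by rewrite -{1}(reflect_seqK t); exact: lexlt_reflect. Qed.

Lemma lexle_reflect s t :
  lexle (reflect_seq s) (reflect_seq t) <-> lexle t s.
Proof.
rewrite /lexle lexlt_reflect; split=> -[h|h]; try by left.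
- by right; rewrite -[t]reflect_seqK -h reflect_seqK.
- by right; rewrite h.
Qed.

Lemma lexlt_behead s t : s 0%N = t 0%N ->
  lexlt (shift 1 s) (shift 1 t) <-> lexlt s t.
Proof.
move=> e0; split=> [[n [e l]]|[[|n] [e l]]].
- exists n.+1; rewrite -addn1; split=> // -[//|i].
  by rewrite addn1 ltnS => /e; rewrite /shift addn1.
- by rewrite e0 ltnn in l.
- exists n; rewrite /shift addn1; split=> // i i_n.
  by rewrite addn1; apply: e.
Qed.

Lemma lexlt_head s t : lexlt s t -> (s 0 <= t 0)%N.
Proof. by case=> [[|n] [e l]]; [exact: ltnW | rewrite e]. Qed.

Lemma head_lexlt s t : (s 0 < t 0)%N -> lexlt s t.
Proof. by move=> l; exists 0%N. Qed.

End Lex.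

(** * Expansions and the branch maps *)

Section Contraction.
Context {R : realType}.

(** An excess that can be postponed [n] steps at the price of a factor [1 / q ^ n], for every [n],
    cannot be positive. *)
Lemma le0_contraction (q c E : R) : 1 < q ->
  (forall n, E <= c / q ^+ n) -> E <= 0.
Proof.
move=> q1 h; have q0 : 0 < q by lra.
have qlt : `|q^-1| < 1.
  by rewrite ger0_norm ?invr_ge0 ?ltW // invf_lt1.
have /cvg_lim := cvg_geometric c qlt => /(_ (@Rhausdorff _)) <-.
apply: limr_ge; first by apply: cvgP; apply: cvg_geometric.
by near=> n; rewrite /= exprVn.
Unshelve. all: by end_near. Qed.

End Contraction.

Section Values.
Context {R : realType} {M : nat} (S : alphabet_base R M).
Implicit Types (s t : dseq M) (x y : R) (j : 'I_M.+1).

Definition branch j y := (dig S j + y) / base S j.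

Lemma base_gt0 j : 0 < base S j.
Proof. exact: lt_trans (base_gt1 S j). Qed.

Lemma branch_lt j x y : (branch j x < branch j y) = (x < y).
Proof. by rewrite ltr_pM2r ?invr_gt0 ?base_gt0 // ltrD2l. Qed.

Lemma branch_le j x y : (branch j x <= branch j y) = (x <= y).
Proof. by rewrite ler_pM2r ?invr_gt0 ?base_gt0 // lerD2l. Qed.

Lemma branchB j x y : branch j x - branch j y = (x - y) / base S j.
Proof. by rewrite /branch -mulrBl; congr (_ / _); ring. Qed.

Lemma branchK j y : branch j (base S j * y - dig S j) = y.
Proof.
rewrite /branch; have := lt0r_neq0 (base_gt0 j) => q0; field.
by rewrite q0.
Qed.

Lemma base_unif : exists2 q : R, 1 < q & forall j, q <= base S j.
Proof.
have [i _ h] := @arg_minP _ _ _ ord0 predT (base S) isT.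
by exists (base S i); [exact: base_gt1 | move=> j; apply: h].
Qed.

Definition pi_term s i := dig S (s i) / \prod_(k < i.+1) base S (s k).

Lemma pi_valE s : pi_val S s = limn (series (pi_term s)).
Proof. by []. Qed.

Lemma pi_termS s i : pi_term s i.+1 = pi_term (shift 1 s) i / base S (s 0%N).
Proof.
rewrite /pi_term big_ord_recl /= invfM [X in _ * X]mulrC mulrA.
rewrite {1}/shift addn1; congr (_ / _ * _); apply: eq_bigr => k _.
by rewrite /shift addn1.
Qed.

Lemma pi_seriesS s n : series (pi_term s) n.+1 =
  branch (s 0%N) (series (pi_term (shift 1 s)) n).
Proof.
rewrite /series /= big_nat_recl // /branch mulrDl; congr (_ + _).
  by rewrite /pi_term big_ord_recl big_ord0 mulr1.
by rewrite mulr_suml; apply: eq_bigr => i _; rewrite pi_termS.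
Qed.

Lemma pi_term_le (D q : R) s i : 1 < q -> (forall j, q <= base S j) ->
  (forall j, `|dig S j| <= D) -> `|pi_term s i| <= D / q ^+ i.+1.
Proof.
move=> q1 hq hD; have q0 : 0 < q by lra.
have D0 : 0 <= D by apply: le_trans (hD ord0).
have h : q ^+ i.+1 <= \prod_(k < i.+1) base S (s k).
  rewrite -[X in q ^+ X]card_ord -prodr_const.
  by apply: ler_prod => k _; rewrite hq ltW.
have h0 : 0 < q ^+ i.+1 by rewrite exprn_gt0.
rewrite normrM [X in _ * X <= _]ger0_norm; last first.
  by rewrite invr_ge0; apply: prodr_ge0 => k _; rewrite ltW ?base_gt0.
apply: ler_pM => //; first by rewrite invr_ge0 (le_trans _ h) ?ltW.
by rewrite lef_pV2 // posrE (lt_le_trans _ h).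
Qed.

Lemma pi_cvg s : cvgn (series (pi_term s)).
Proof.
have [q q1 hq] := base_unif; have q0 : 0 < q by lra.
pose D := \sum_j `|dig S j|.
have hD j : `|dig S j| <= D.
  by rewrite /D (bigD1 j) //= lerDl sumr_ge0.
have D0 : 0 <= D by apply: le_trans (hD ord0).
apply: normed_cvg; apply: (@series_le_cvg _ _ (geometric (D / q) q^-1)).
- by move=> n; rewrite normr_ge0.
- move=> n /=; apply: mulr_ge0; first by rewrite divr_ge0 // ltW.
  by rewrite exprn_ge0 // invr_ge0 ltW.
- move=> n /=; apply: le_trans (pi_term_le s n q1 hq hD) _.
  by rewrite exprVn exprS invfM mulrA.
apply: is_cvg_geometric_series.
by rewrite ger0_norm ?invr_ge0 ?ltW // invf_lt1.
Qed.

Lemma pi_valS s : pi_val S s = branch (s 0%N) (pi_val S (shift 1 s)).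
Proof.
apply: cvg_lim => //; rewrite -cvg_shiftS /=.
rewrite (_ : (fun n => _) = fun n =>
   branch (s 0%N) (series (pi_term (shift 1 s)) n)); last first.
  by apply/funext => n; rewrite -pi_seriesS.
by apply: cvgMr_tmp; apply: cvgD; [exact: cvg_cst | exact: pi_cvg].
Qed.

Lemma pi_val_cseq j : pi_val S (cseq j) = branch j (pi_val S (cseq j)).
Proof. by rewrite {1}pi_valS. Qed.

(** [Q] is the product of the bases along the common prefix, of which only [1 <= Q] is kept. *)
Lemma pi_val_prefix n s t : (forall i, (i < n)%N -> s i = t i) ->
  exists2 Q : R, 1 <= Q & 
  pi_val S s - pi_val S t = (pi_val S (shift n s) - pi_val S (shift n t)) / Q.
Proof.
elim: n s t => [|n IHn] s t h; first by exists 1; rewrite // !shift0 divr1.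
have [i i_n|Q Q1 e] := IHn (shift 1 s) (shift 1 t).
  by rewrite /shift addn1 h.
exists (base S (s 0%N) * Q).
  by have := base_gt1 S (s 0%N); nra.
rewrite [in LHS](pi_valS s) [in LHS](pi_valS t) -h // branchB e !shiftD addn1.
by rewrite invfM mulrA mulrAC.
Qed.

Lemma pi_val_prefix_lt n s t : (forall i, (i < n)%N -> s i = t i) ->
  (pi_val S s < pi_val S t) = (pi_val S (shift n s) < pi_val S (shift n t)).
Proof.
move=> /pi_val_prefix [Q Q1 e]; rewrite -subr_lt0 e pmulr_llt0 ?subr_lt0 //.
by rewrite invr_gt0 (lt_le_trans _ Q1).
Qed.

Lemma pi_val_prefix_eq n s t : (forall i, (i < n)%N -> s i = t i) ->
  pi_val S s = pi_val S t -> pi_val S (shift n s) = pi_val S (shift n t).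
Proof.
move=> /pi_val_prefix [Q Q1 e] h; move/eqP: e; rewrite h subrr eq_sym.
rewrite mulf_eq0 invr_eq0 subr_eq0 => /orP[/eqP //|/eqP Q0].
by move: Q1; rewrite Q0 ler10.
Qed.

Lemma lambda_le j : lambda S <= pi_val S (cseq j).
Proof. exact: bigmin_le. Qed.

Lemma le_Lambda j : pi_val S (cseq j) <= Lambda S.
Proof. exact: le_bigmax. Qed.

Lemma lambda_attained : exists j, pi_val S (cseq j) <= lambda S.
Proof. by have /bigmin_leP [|[j _]] := lexx (lambda S); [exists ord0|exists j]. Qed.

Lemma Lambda_attained : exists j, Lambda S <= pi_val S (cseq j).
Proof. by have /bigmax_geP [|[j _]] := lexx (Lambda S); [exists ord0|exists j]. Qed.

End Values.

(** * Reflection of an alphabet-base system *)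

Definition reflect_sys {R : realType} {M : nat} (S : alphabet_base R M) :=
  @AlphabetBase R M (fun j => - dig S (rev_ord j)) (fun j => base S (rev_ord j))
    (fun j => base_gt1 S (rev_ord j)).

Section Reflection.
Context {R : realType} {M : nat} (S : alphabet_base R M).
Implicit Types (s t : dseq M) (x y : R) (j : 'I_M.+1).
Local Notation S' := (reflect_sys S).

Lemma pi_val_reflect s : pi_val S' (reflect_seq s) = - pi_val S s.
Proof.
rewrite !pi_valE -limN; last exact: pi_cvg.
congr (limn _); apply/funext => n; rewrite !fctE /series /= -sumrN.
apply: eq_bigr => i _; rewrite /pi_term /= rev_ordK mulNr.
by congr (- (_ / _)); apply: eq_bigr => k _; rewrite /= rev_ordK.
Qed.

Lemma pi_val_reflectr s : pi_val S' s = - pi_val S (reflect_seq s).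
Proof. by rewrite -pi_val_reflect reflect_seqK. Qed.

Lemma branch_reflect j y : branch S' j y = - branch S (rev_ord j) (- y).
Proof. by rewrite /branch /= -mulNr opprD opprK. Qed.

Lemma lambda_reflect : lambda S' = - Lambda S.
Proof.
apply/eqP; rewrite eq_le; apply/andP; split.
  have [j h] := Lambda_attained S.
  apply: le_trans (lambda_le _ (rev_ord j)) _.
  by rewrite pi_val_reflectr reflect_cseq rev_ordK lerN2.
have [j] := lambda_attained S'; apply: le_trans.
by rewrite pi_val_reflectr reflect_cseq lerN2 le_Lambda.
Qed.

Lemma Lambda_reflect : Lambda S' = - lambda S.
Proof.
apply/eqP; rewrite eq_le; apply/andP; split; last first.
  have [j h] := lambda_attained S.
  apply: le_trans (le_Lambda _ (rev_ord j)).
  by rewrite pi_val_reflectr reflect_cseq rev_ordK lerN2.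
have [j] := Lambda_attained S'; move=> /le_trans; apply.
by rewrite pi_val_reflectr reflect_cseq lerN2 lambda_le.
Qed.

Lemma reflect_regular : regular S -> regular S'.
Proof.
move=> hS i j eij; have [] := hS (rev_ord j) (rev_ord i).
  by rewrite /= eij; have := ltn_ord j; lia.
rewrite lambda_reflect Lambda_reflect.
rewrite -/(branch S _ _) -/(branch S _ _) -/(branch S (rev_ord j) _) -/(branch S (rev_ord i) _).
rewrite -/(branch S' i _) -/(branch S' j _) -/(branch S' i _) -/(branch S' j _).
by rewrite !branch_reflect !opprK !ltrN2 !lerN2.
Qed.

End Reflection.

(** * Extremal values in a regular system *)

Section Regular.
Context {R : realType} {M : nat} (S : alphabet_base R M) (hS : regular S).
Implicit Types (s t : dseq M) (x y : R) (j : 'I_M.+1).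
Local Notation f := (branch S).
Local Notation lam := (lambda S).
Local Notation Lam := (Lambda S).

Lemma branch_mono_ends (i j : 'I_M.+1) : (i < j)%N ->
  f i lam < f j lam /\ f i Lam < f j Lam.
Proof.
have [n] := ubnP j; elim: n i j => // n IHn i j; rewrite ltnS => jn ij.
have j'M : (j.-1 < M.+1)%N by have := ltn_ord j; lia.
have [] := hS (i := Ordinal j'M) (j := j); first by rewrite /=; lia.
move=> h1 h2 _; have [e|ne] := eqVneq (i : nat) j.-1.
  by rewrite (_ : i = Ordinal j'M) //; apply: val_inj.
have [||h3 h4] := IHn i (Ordinal j'M) => /=; try lia.
by split; [apply: lt_trans h3 h1 | apply: lt_trans h4 h2].
Qed.

Lemma branch_lambda_le (i j : 'I_M.+1) : (i <= j)%N -> f i lam <= f j lam.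
Proof.
rewrite leq_eqVlt => /orP[/eqP /val_inj -> //|].
by move/branch_mono_ends => [/ltW].
Qed.

(** [f j] contracts towards its fixed point [p >= lam], so it does not move [lam] down. *)
Lemma lambda_le_branch j : lam <= f j lam.
Proof.
have q1 := base_gt1 S j; have := lambda_le S j; rewrite {1}pi_val_cseq.
set p := pi_val S _ => h; have e : p = f j p by exact: pi_val_cseq.
have := branchB S j p lam; rewrite -e -/p => e2.
have h2 : lam <= p by rewrite e.
suff : (p - lam) / base S j <= p - lam by lra.
by rewrite ler_pdivrMr ?base_gt0 //; nra.
Qed.

(** If the fixed point [p] of [f j] attains the minimum, then [f ord0 lam <= f j lam <= f j p = p <=
    lam]. *)
Lemma branch0_lambda : f ord0 lam = lam.
Proof.
apply/eqP; rewrite eq_le lambda_le_branch andbT.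
have [j h] := lambda_attained S; apply: le_trans (@branch_lambda_le ord0 j (leq0n j)) _.
apply: le_trans h; rewrite [X in _ <= X]pi_val_cseq branch_le.
exact: lambda_le.
Qed.

(** Partial sums of [n] terms fall short of [lam] by at most [|lam| / q ^ n], since no branch moves
    [lam] down and each divides gaps by at least [q]. *)
Lemma pi_val_ge s : lam <= pi_val S s.
Proof.
have [q q1 hq] := base_unif S; have q0 : 0 < q by lra.
have h n : lam - series (pi_term S s) n <= geometric `|lam| q^-1 n.
  elim: n s => [|n IHn] s.
    by rewrite /series /= big_nil subr0 mulr1 ler_norm.
  have step : lam - series (pi_term S s) n.+1 <=
      (lam - series (pi_term S (shift 1 s)) n) / base S (s 0%N).
    by rewrite pi_seriesS -branchB lerB // lambda_le_branch.
  apply: le_trans step _; apply: le_trans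
    (_ : (geometric `|lam| q^-1 n) / base S (s 0%N) <= _).
    by rewrite ler_pM2r ?invr_gt0 ?base_gt0.
  rewrite /= exprSr mulrA ler_wpM2l //; last by rewrite lef_pV2 // posrE base_gt0.
  by rewrite mulr_ge0 // exprn_ge0 // invr_ge0 ltW.
have qlt : `|q^-1| < 1 by rewrite ger0_norm ?invr_ge0 ?ltW // invf_lt1.
have cg := cvg_geometric `|lam| qlt.
have cs : lam - series (pi_term S s) n @[n --> \oo] --> lam - pi_val S s.
  by apply: cvgB; [exact: cvg_cst | exact: pi_cvg].
rewrite -subr_le0; apply: ler_cvg_to cs cg _.
exact: nearW.
Qed.

End Regular.

Section RegularUpper.
Context {R : realType} {M : nat} (S : alphabet_base R M) (hS : regular S).
Implicit Types (s t : dseq M) (x y : R) (j : 'I_M.+1).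
Local Notation f := (branch S).
Local Notation lam := (lambda S).
Local Notation Lam := (Lambda S).

Lemma pi_val_le s : pi_val S s <= Lam.
Proof.
have := pi_val_ge (reflect_sys S) (reflect_seq s).
by rewrite pi_val_reflect lambda_reflect lerN2.
Qed.

Lemma branchM_Lambda : f ord_max Lam = Lam.
Proof.
have := branch0_lambda (reflect_regular hS).
by rewrite branch_reflect lambda_reflect opprK rev_ord0 => /oppr_inj.
Qed.

(** Digits determine a bounded orbit: after [n] branches the gap between the two values is at most
    [(Lam - lam) / q ^ n]. *)
Lemma pi_val_orbit (r : nat -> R) s :
  (forall n, lam <= r n <= Lam) -> (forall n, r n = f (s n) (r n.+1)) ->
  pi_val S s = r 0%N.
Proof.
move=> hr hs; have [q q1 hq] := base_unif S; have q0 : 0 < q by lra.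
suff h n : `|pi_val S s - r 0%N| <= (Lam - lam) / q ^+ n.
  apply/eqP; rewrite -subr_eq0 -normr_le0; exact: le0_contraction q1 h.
elim: n s r hr hs => [|n IHn] s r hr hs.
  rewrite divr1 ler_norml; have := hr 0%N; have := pi_val_le s.
  by have := pi_val_ge S s; lra.
have := IHn (shift 1 s) (fun n => r n.+1) (fun n => hr n.+1).
move=> /(_ _) h; rewrite pi_valS hs branchB normrM.
rewrite [X in _ * X]ger0_norm; last by rewrite invr_ge0 ltW ?base_gt0.
rewrite exprSr invfM mulrA; apply: ler_pM => //.
- by rewrite invr_ge0 ltW ?base_gt0.
- by apply: h => n'; rewrite hs /shift addn1.
- by rewrite lef_pV2 // posrE base_gt0.
Qed.

Lemma pi_val0 : pi_val S (cseq ord0) = lam.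
Proof.
have hlL : lam <= Lam by apply: le_trans (pi_val_ge S (cseq ord0)) (pi_val_le _).
apply: (pi_val_orbit (r := fun=> lam)) => n; first by rewrite lexx.
by rewrite /cseq branch0_lambda.
Qed.

(** A nonzero first digit [j] would give a value at least [f j lam > f ord0 lam = lam]; so the first
    digit is 0, and the tail has value [lam] again. *)
Lemma pi_val_eq_lambda s : pi_val S s = lam -> s = cseq ord0.
Proof.
move=> h; suff hn n : s n = ord0 /\ pi_val S (shift n s) = lam.
  by apply/funext => n; have [] := hn n.
have step t : pi_val S t = lam -> t 0%N = ord0 /\ pi_val S (shift 1 t) = lam.
  move=> ht; have t0 : t 0%N = ord0.
    case: (posnP (t 0%N)) => [e|/(branch_mono_ends hS (i := ord0)) [h0 _]].
      exact: val_inj.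
    move: h0; rewrite branch0_lambda // -{1}ht pi_valS branch_lt ltNge.
    by rewrite pi_val_ge.
  split=> //; apply/eqP; rewrite eq_le pi_val_ge // andbT.
  by rewrite -(branch_le S ord0) -{1}t0 -pi_valS ht branch0_lambda.
elim: n => [|n [_ /step []]]; first by have [] := step _ h; rewrite shift0.
rewrite shiftD => e1 e2; rewrite -[n.+1]add1n; split=> //.
have /step [] // := e2.
Qed.

End RegularUpper.

(** * Lexicographic characterization of unique expansions *)

Section QuasiGreedy.
Context {R : realType} {M : nat} (S : alphabet_base R M) (hS : regular S).
Implicit Types (s t u : dseq M) (x y : R) (j : nat).
Local Notation f := (branch S).
Local Notation lam := (lambda S).
Local Notation Lam := (Lambda S).

(** Each digit is the largest [j] with [f j lam] strictly below the tail value; strictness rules out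
    a tail [0^infty]. *)
Definition quasi_greedy s := forall n, lam < pi_val S (shift n s) /\
  forall j : 'I_M.+1, (s n < j)%N -> pi_val S (shift n s) <= f j lam.

(** The range condition on [y] sits inside the existential so that [choice] yields a digit function
    on all reals. *)
Lemma quasi_greedy_digit y : exists j : 'I_M.+1, lam < y <= Lam ->
  f j lam < y <= f j Lam /\ forall i : 'I_M.+1, (j < i)%N -> y <= f i lam.
Proof.
have [/andP[ly yL]|ny] := boolP (lam < y <= Lam); last by exists ord0.
have h0 : f ord0 lam < y by rewrite branch0_lambda.
have [j hj jmax] := @arg_maxnP _ ord0 (fun j : 'I_M.+1 => f j lam < y) (fun j : 'I_M.+1 => j) h0.
have jmax' (i : 'I_M.+1) : (j < i)%N -> y <= f i lam.
  by rewrite leNgt; apply: contraTN => /jmax; rewrite -leqNgt.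
exists j => _; split=> //; rewrite hj /=.
have [jM|Mj] := ltnP j M.
  have j1M : (j.+1 < M.+1)%N by [].
  by have [_ _] := hS (i := j) (j := Ordinal j1M) erefl; apply: le_trans; apply: jmax'.
have -> : j = ord_max by apply: val_inj; rewrite /=; have := ltn_ord j; lia.
by rewrite branchM_Lambda.
Qed.

Lemma quasi_greedy_exists x : lam < x <= Lam ->
  exists2 s, quasi_greedy s & pi_val S s = x.
Proof.
move=> hx; have [d hd] := choice quasi_greedy_digit.
(* [rho] strips the chosen digit by inverting its branch; it maps the interval of [x] with
   [lam < x <= Lam] into itself. *)
pose rho y := base S (d y) * y - dig S (d y).
have rhoE y : f (d y) (rho y) = y by exact: branchK.
pose r n := iter n rho x.
have hr n : lam < r n <= Lam.
  elim: n => // n IHn; have [+ _] := hd _ IHn.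
  by rewrite -{2 3}(rhoE (r n)) branch_lt branch_le.
pose s n := d (r n).
have piE n : pi_val S (shift n s) = r n.
  rewrite (pi_val_orbit (r := fun k => r (k + n)%N)) // => k.
    by have /andP[/ltW -> ->] := hr (k + n)%N.
  by rewrite -[LHS]rhoE.
exists s; last by rewrite -[s]shift0 piE.
by move=> n; rewrite piE; have /andP[-> _] := hr n; have [] := hd _ (hr n).
Qed.

Lemma pi_val_onto x : lam <= x <= Lam -> exists s, pi_val S s = x.
Proof.
move=> /andP[]; rewrite le_eqVlt => /orP[/eqP <- _|lx xL].
  by exists (cseq ord0); apply: pi_val0.
by have [|s _] := quasi_greedy_exists (x := x); [rewrite lx | exists s].
Qed.

Lemma branch_pi_val_shift s n :
  pi_val S (shift n s) = f (s n) (pi_val S (shift n.+1 s)).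
Proof. by rewrite pi_valS shiftD add1n. Qed.

(** If [s] had the smaller digit at the first difference, its tail value there would be at most
    [f j lam], with [j] the digit of [t], hence at most that of [t]. *)
Lemma quasi_greedy_lt s t :
  quasi_greedy s -> pi_val S t < pi_val S s -> lexlt t s.
Proof.
move=> gs ts; case: (lex_total s t) => [e|[n [e l]]|] //.
  by rewrite e ltxx in ts.
have {}e i : (i < n)%N -> t i = s i by move/e.
have := ts; rewrite (pi_val_prefix_lt S e).
have [_ /(_ _ l) h] := gs n; move/lt_le_trans => /(_ _ h).
by rewrite branch_pi_val_shift branch_lt ltNge pi_val_ge.
Qed.

Lemma quasi_greedy_infinite s : quasi_greedy s -> ~ fin_seq s.
Proof.
move=> gs [n [_ h]]; have [] := gs n.+1.
rewrite (_ : shift n.+1 s = cseq ord0) ?pi_val0 ?ltxx //.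
by apply/funext => i; rewrite /shift h // ltn_addl.
Qed.

(** If [t] were larger, equality of the values would force the tail of [t] after the first
    difference to be [0^infty], making [t] finite. *)
Lemma quasi_greedy_max s t :
  quasi_greedy s -> pi_val S t = pi_val S s -> ~ fin_seq t -> lexle t s.
Proof.
move=> gs ts inft; case: (lex_total s t) => [->|[n [e l]]|]; [by right| |by left].
have est := pi_val_prefix_eq e (esym ts).
have [_ /(_ _ l)] := gs n; rewrite est branch_pi_val_shift branch_le => h.
have /(pi_val_eq_lambda hS) h0 : pi_val S (shift n.+1 t) = lam.
  by apply/eqP; rewrite eq_le h pi_val_ge.
case: inft; exists n; split; first exact: leq_ltn_trans l.
move=> i ni; have := congr1 (fun v => v (i - n.+1)%N) h0.
by rewrite /shift /cseq subnK.
Qed.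

Lemma quasi_greedy_largest s :
  quasi_greedy s -> largest_infinite_expansion S (pi_val S s) s.
Proof.
move=> gs; split=> //; first exact: quasi_greedy_infinite.
by move=> t; apply: quasi_greedy_max.
Qed.

Lemma a_exp_eq s x : largest_infinite_expansion S x s -> a_exp S x = s.
Proof.
move=> hs; apply: xget_unique => // t [et it mt]; case: hs => es is_ ms.
by apply: lexle_anti; [apply: ms | apply: mt].
Qed.

Definition alpha_arg (j : nat) : R :=
  base S (inord j) * ((dig S (inord j.+1) + lam) / base S (inord j.+1)
          - dig S (inord j) / base S (inord j)).

Lemma branch_alpha_arg j :
  f (inord j) (alpha_arg j) = f (inord j.+1) lam.
Proof.
rewrite -[RHS](@branchK _ _ S (inord j)); congr branch.
rewrite /alpha_arg mulrBr; congr (_ - _).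
by rewrite mulrC divfK // lt0r_neq0 // base_gt0.
Qed.

Lemma alpha_arg_itv j : (j < M)%N -> lam < alpha_arg j <= Lam.
Proof.
move=> jM; have [|h1 h2 h3] := hS (i := inord j) (j := inord j.+1).
  by rewrite !inordK //; lia.
by rewrite -(branch_lt S (inord j)) -(branch_le S (inord j)) branch_alpha_arg h1.
Qed.

Lemma alpha_spec j : (j < M)%N ->
  quasi_greedy (alpha S j) /\ pi_val S (alpha S j) = alpha_arg j.
Proof.
move=> /alpha_arg_itv /quasi_greedy_exists [s gs es].
suff -> : alpha S j = s by [].
by apply: a_exp_eq; rewrite -/(alpha_arg j) -es; apply: quasi_greedy_largest.
Qed.

Lemma branch_alpha j : (j < M)%N ->
  f (inord j) (pi_val S (alpha S j)) = f (inord j.+1) lam.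
Proof. by move=> /alpha_spec [_ ->]; rewrite branch_alpha_arg. Qed.

Definition upper_admissible s := forall n, (s n < M)%N ->
  lexlt (shift n.+1 s) (alpha S (s n)).

Lemma upper_admissible_shift n s :
  upper_admissible s -> upper_admissible (shift n s).
Proof. by move=> h k hk; rewrite shiftD addSn; apply: h. Qed.

(** At the first difference [n], [alpha S j] has the larger digit and a tail above [lam], so its
    value from [n] on exceeds [f (u n + 1) lam], the image under [f (u n)] of the value of
    [alpha S (u n)]. The comparison restarts with the next tail of [u] and [alpha S (u n)]. *)
Lemma upper_admissible_step (q : R) u (j : nat) : (forall i, q <= base S i) ->
  upper_admissible u -> (j < M)%N -> lexlt u (alpha S j) ->
  exists n, exists2 Q : R, q <= Q & (u n < M)%N /\
    pi_val S u - pi_val S (alpha S j) <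
    (pi_val S (shift n.+1 u) - pi_val S (alpha S (u n))) / Q.
Proof.
move=> hq uu jM [n [e l]]; have [ga _] := alpha_spec jM.
have unM : (u n < M)%N by have := ltn_ord (alpha S j n); lia.
exists n; have [Q Q1 ->] := pi_val_prefix S e.
have q0 := base_gt0 S (u n); exists (base S (u n) * Q).
  by apply: le_trans (hq (u n)) _; nra.
split=> //; rewrite [(_ * Q)^-1]invfM mulrA ltr_pM2r ?invr_gt0 ?(lt_le_trans _ Q1) //.
rewrite -branchB -branch_pi_val_shift ltrD2l ltrN2.
have := branch_alpha unM; rewrite inord_val => ->.
have [ln _] := ga n.+1; rewrite [ltRHS]branch_pi_val_shift.
apply: le_lt_trans (_ : f (alpha S j n) lam < _); last by rewrite branch_lt.
by apply: branch_lambda_le; rewrite ?inordK.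
Qed.

(* The excess of [pi_val S u] over the bound at one step is at most the excess
   at a later step divided by a ratio bounded below by [q > 1], so it cannot
   be positive. *)
Lemma upper_admissible_lt u (j : nat) : upper_admissible u -> (j < M)%N ->
  lexlt u (alpha S j) -> pi_val S u < pi_val S (alpha S j).
Proof.
move=> uu jM uj; have [q q1 hq] := base_unif S; have q0 : 0 < q by lra.
have hle v k : upper_admissible v -> (k < M)%N -> lexlt v (alpha S k) ->
    pi_val S v - pi_val S (alpha S k) <= 0.
  move=> uv kM vk; apply: (le0_contraction (c := Lam - lam) q1) => N.
  elim: N v k uv kM vk => [|N IHN] v k uv kM vk.
    by rewrite divr1 lerB ?pi_val_le ?pi_val_ge.
  have [n [Q qQ [vnM /ltW h]]] := upper_admissible_step hq uv kM vk.
  apply: le_trans h _; have Q0 : 0 < Q by apply: lt_le_trans qQ.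
  rewrite exprSr invfM mulrA.
  apply: le_trans (_ : (Lam - lam) / q ^+ N / Q <= _).
    rewrite ler_pM2r ?invr_gt0 //; apply: IHN => //; last exact: uv.
    exact: upper_admissible_shift.
  rewrite ler_wpM2l ?lef_pV2 // divr_ge0 ?exprn_ge0 ?(ltW q0) // subr_ge0.
  exact: le_trans (pi_val_ge S u) (pi_val_le S u).
(* One strict step followed by the weak bound [hle] gives strictness. *)
have [n [Q qQ [unM h]]] := upper_admissible_step hq uu jM uj.
rewrite -subr_lt0; apply: lt_le_trans h _.
rewrite pmulr_lle0 ?invr_gt0 ?(lt_le_trans _ qQ) //; apply: hle => //.
  exact: upper_admissible_shift.
exact: uu.
Qed.

(** At the first difference, admissibility keeps the value of [s] strictly below [f (s n + 1) lam],
    while a larger digit of [t] brings its value at least there. *)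
Lemma upper_admissible_nlt s t :
  upper_admissible s -> pi_val S t = pi_val S s -> ~ lexlt s t.
Proof.
move=> us ets [n [e l]]; have est := pi_val_prefix_eq e (esym ets).
have snM : (s n < M)%N by have := ltn_ord (t n); lia.
have := upper_admissible_lt (upper_admissible_shift (n := n.+1) us) snM (us n snM).
rewrite -(branch_lt S (s n)) -branch_pi_val_shift est branch_pi_val_shift ltNge.
have := branch_alpha snM; rewrite inord_val => ->.
rewrite (le_trans (_ : _ <= f (t n) lam)) ?branch_le ?pi_val_ge //.
by apply: branch_lambda_le; rewrite ?inordK.
Qed.

(** If the tail after a digit [j < M] reached the value of [alpha S j], the value at that position
    would also lie in the range of the branch [j + 1], giving a second expansion. *)
Lemma unique_upper_admissible s :
  (forall t, pi_val S t = pi_val S s -> t = s) -> upper_admissible s.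
Proof.
move=> uniq_s n snM; have [ga _] := alpha_spec snM.
apply: (quasi_greedy_lt ga); rewrite ltNge; apply/negP => h.
set y := pi_val S (shift n.+1 s) in h.
pose i1 : 'I_M.+1 := inord (s n).+1.
have [|h1 h2 h3] := hS (i := s n) (j := i1); first by rewrite /= inordK.
have ge1 : f i1 lam <= f (s n) y.
  by have := branch_alpha snM; rewrite inord_val => <-; rewrite branch_le.
have le2 : f (s n) y <= f i1 Lam.
  by apply: le_trans (ltW h2); rewrite branch_le pi_val_le.
rewrite -(branchK S i1 (f (s n) y)) !branch_le in ge1 le2.
have [|u pu] := @pi_val_onto (base S i1 * f (s n) y - dig S i1).
  by rewrite ge1.
pose t : dseq M := fun k =>
  if (k < n)%N then s k else if k == n then i1 else u (k - n.+1)%N.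
have st k : (k < n)%N -> s k = t k by rewrite /t => ->.
have tn : t n = i1 by rewrite /t ltnn eqxx.
have tu : shift n.+1 t = u.
  apply/funext => k; rewrite /shift /t addnS ltnNge leqW ?leq_addl //=.
  by rewrite subSS addnK gtn_eqF // ltnS leq_addl.
have : t = s.
  apply: uniq_s; apply/esym/eqP; rewrite -subr_eq0.
  have [Q _ ->] := pi_val_prefix S st; rewrite (branch_pi_val_shift t) tn tu pu.
  by rewrite branchK branch_pi_val_shift subrr mul0r.
move/(congr1 (fun v : dseq M => v n : nat)); rewrite tn /i1 inordK //; lia.
Qed.

End QuasiGreedy.

(** * Two-sided characterization and the sequences [gamma] *)

Section Characterization.
Context {R : realType} {M : nat} (S : alphabet_base R M) (hS : regular S).
Implicit Types (s t u : dseq M) (x y : R) (j : nat).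
Local Notation S' := (reflect_sys S).

Lemma univoque_seqP s : univoque_seq S s <->
  upper_admissible S s /\ upper_admissible S' (reflect_seq s).
Proof.
split=> [[_ [t [pt ut]]]|[us us']].
  have uniq_s v : pi_val S v = pi_val S s -> v = s.
    by move=> pv; rewrite -(ut v) // -(ut s).
  split; apply: unique_upper_admissible => // [|v].
    exact: reflect_regular.
  rewrite pi_val_reflect pi_val_reflectr => /oppr_inj /uniq_s <-.
  by rewrite reflect_seqK.
split; first by rewrite pi_val_ge pi_val_le.
exists s; split=> // t pt; case: (lex_total s t) => // h.
  by case: (upper_admissible_nlt hS us pt).
case: (upper_admissible_nlt (reflect_regular hS) us' (t := reflect_seq t)).
  by rewrite !pi_val_reflect pt.
by apply/lexlt_reflect.
Qed.

Lemma fin_seq_reflect s : fin_seq (reflect_seq s) <-> cofin_seq s.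
Proof.
split=> -[n [h e]]; exists n; split.
- by move: h; rewrite reflect_seqE; lia.
- by move=> i /e /(congr1 (@rev_ord _)); rewrite rev_ordK rev_ord0.
- by rewrite reflect_seqE; lia.
- by move=> i /e h'; rewrite /reflect_seq h' rev_ord_max.
Qed.

Lemma smallest_coinfinite_reflect x s : smallest_coinfinite_expansion S x s <->
  largest_infinite_expansion S' (- x) (reflect_seq s).
Proof.
have e t : expansion S' (- x) t <-> expansion S x (reflect_seq t).
  by rewrite /expansion pi_val_reflectr; split=> [/oppr_inj|->].
split=> -[h1 h2 h3]; split.
- by apply/e; rewrite reflect_seqK.
- by rewrite fin_seq_reflect.
- move=> t /e ht it; rewrite -(reflect_seqK t); apply/lexle_reflect/h3 => //.
  by rewrite -fin_seq_reflect reflect_seqK.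
- by move/e: h1; rewrite reflect_seqK.
- by rewrite -fin_seq_reflect.
- move=> t ht it; apply/lexle_reflect/h3; last by rewrite fin_seq_reflect.
  by apply/e; rewrite reflect_seqK.
Qed.

Lemma gamma_reflect j : (j < M)%N ->
  gamma S (M - j) = reflect_seq (alpha S' j).
Proof.
move=> jM; have hS' := reflect_regular hS.
have [ga pa] := alpha_spec hS' jM.
have rE k : (k <= M)%N -> rev_ord (inord k) = inord (M - k) :> 'I_M.+1.
  by move=> kM; apply: val_inj; rewrite /= !inordK ?subSS //; lia.
have argE : alpha_arg S' j =
    - (base S (inord (M - j)) * ((dig S (inord (M - j).-1) + Lambda S)
    / base S (inord (M - j).-1) - dig S (inord (M - j)) / base S (inord (M - j)))).
  rewrite /alpha_arg /= lambda_reflect !rE //; last exact: ltnW.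
  by rewrite subnS -opprD !mulNr -opprD mulrN.
apply: xget_unique.
  apply/smallest_coinfinite_reflect; rewrite reflect_seqK -argE -pa.
  exact: quasi_greedy_largest.
move=> t /smallest_coinfinite_reflect; rewrite -argE => /a_exp_eq h.
by rewrite -[t]reflect_seqK -h.
Qed.

End Characterization.

(** * The threshold [alphaGR] *)

Section Below.
Context {M : nat}.
Implicit Types (s t u K : dseq M) (r : dseq M -> dseq M -> Prop).

(** One threshold [K] replaces all the [alpha]; [r] is a parameter because strict, weak and
    prefix-bounded comparisons all occur. *)
Definition below r K s := forall n,
  ((s n < M)%N -> r (shift n.+1 s) K) /\
  ((0 < s n)%N -> r (reflect_seq (shift n.+1 s)) K).

Lemma below_shift r K n s : below r K s -> below r K (shift n s).
Proof. by move=> h k; rewrite shiftD addSn; apply: h. Qed.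

Lemma below_reflect r K s : below r K s -> below r K (reflect_seq s).
Proof.
move=> h k; have [h1 h2] := h k; rewrite -reflect_shift reflect_seqK.
rewrite reflect_seqE; have := ltn_ord (s k); split => ?.
  by apply: h2; lia.
by apply: h1; lia.
Qed.

End Below.

Section GR.
Context {M : nat} (hM : (1 <= M)%N).
Implicit Types (s t u : dseq M).
Local Notation GR := (alphaGR M).

Lemma alphaGR0 : GR 0%N = M.+1./2 :> nat.
Proof. by rewrite /alphaGR; case: ifP => oM; rewrite ?inordK //=; lia. Qed.

Lemma alphaGR_shift : shift 1 GR = reflect_seq GR.
Proof.
apply/funext => i; apply: val_inj.
rewrite /shift addn1 -[RHS]/(nat_of_ord _) reflect_seqE /alphaGR.
case: ifP => oM; last by rewrite /= !inordK //; lia.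
by rewrite /=; case: (odd i); rewrite /= !inordK //; lia.
Qed.

(** With equal heads, the reflected bound puts the tail of [s] above the reflection of [GR], which
    is the tail of [GR], against [s < GR]. *)
Lemma below_GR_head s : below lexlt GR s -> lexlt s GR -> s 0%N <> GR 0%N.
Proof.
move=> b sGR e; have [_ h0] := b 0%N.
have {h0} /lexlt_reflectl h : lexlt (reflect_seq (shift 1 s)) GR.
  by apply: h0; rewrite e alphaGR0 /=; lia.
by move: sGR; rewrite -(lexlt_behead e) alphaGR_shift => /lexlt_asym.
Qed.

Lemma below_GR_head_lt s : below lexlt GR s -> lexlt s GR -> (s 0 < M.+1./2)%N.
Proof.
move=> b h; rewrite -alphaGR0 ltn_neqAle lexlt_head // andbT.
by apply/eqP => /val_inj; apply: below_GR_head.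
Qed.

(** A positive next digit would also be less than [M], so the tail after it and the reflection of
    that tail would both start below [M.+1./2]; but these two digits add up to [M]. *)
Lemma below_GR_next s n : below lexlt GR s -> (s n < M)%N -> s n.+1 = ord0.
Proof.
move=> b snM; apply: val_inj; apply/eqP; rewrite /= -leqn0 leqNgt; apply/negP => s1.
have [/(_ snM) h _] := b n; have := below_GR_head_lt (below_shift n.+1 b) h.
rewrite {1}/shift add0n => l1; have [h2 h3] := b n.+1.
have {}h2 := h2 ltac:(lia); have {}h3 := h3 s1.
have := below_GR_head_lt (below_shift n.+2 b) h2.
have := below_GR_head_lt (below_reflect (below_shift n.+2 b)) h3.
rewrite reflect_seqE; have := odd_double_half M.+1; lia.
Qed.

Lemma below_GR s : below lexlt GR s -> s = cseq ord0 \/ s = cseq ord_max.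
Proof.
move=> b; have down n := @below_GR_next s n b.
have up n : (0 < s n)%N -> s n.+1 = ord_max.
  move=> h; have := below_GR_next (n := n) (below_reflect b).
  rewrite reflect_seqE => /(_ ltac:(have := ltn_ord (s n); lia)).
  by move=> /(congr1 (@rev_ord _)); rewrite rev_ordK rev_ord0.
have [e|s0] := posnP (s 0%N).
  left; apply/funext; elim=> [|n IHn]; first exact: val_inj.
  by rewrite /cseq down // IHn.
right; have s0M : s 0%N = ord_max.
  apply: val_inj; apply/eqP; rewrite /= eqn_leq -ltnS ltn_ord /= leqNgt.
  apply/negP => /down; rewrite up // => /(congr1 val) /=; lia.
apply/funext; elim=> [|n IHn] //.
by rewrite /cseq up // IHn.
Qed.

Definition zeros_GR (n : nat) : dseq M :=
  fun i => if (i < n)%N then ord0 else GR (i - n)%N.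

Lemma reflect_alphaGR_le : lexle (reflect_seq GR) GR.
Proof.
case: (boolP (odd M)) => oM.
  left; apply: head_lexlt; rewrite reflect_seqE alphaGR0; lia.
right; apply/funext => i; apply: val_inj.
by rewrite -[LHS]/(nat_of_ord _) reflect_seqE /alphaGR (negbTE oM) /= inordK; lia.
Qed.

(** Shifting [GR] by one reflects it, so its only tails are [GR] and its reflection. *)
Lemma shift_alphaGR_le n :
  lexle (shift n GR) GR /\ lexle (reflect_seq (shift n GR)) GR.
Proof.
elim: n => [|n [IH1 IH2]].
  by rewrite shift0; split; [right | exact: reflect_alphaGR_le].
rewrite -(addn1 n) -shiftD alphaGR_shift -reflect_shift reflect_seqK.
by split.
Qed.

Lemma zeros_GR_below n : below lexle GR (zeros_GR n).
Proof.
have tail k : shift (n + k) (zeros_GR n) = shift k GR.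
  apply/funext => i; rewrite /shift /zeros_GR ltnNge addnCA leq_addr /=.
  by congr (GR _); lia.
move=> k; have [nk|kn] := leqP n k.
  rewrite -(subnKC nk) -addnS tail; have [h1 h2] := shift_alphaGR_le (k - n).+1.
  by split.
split; last by rewrite /zeros_GR kn.
move=> _; move: kn; rewrite leq_eqVlt => /orP[/eqP->|kn].
  by right; rewrite -[X in shift X _](addn0 n) tail shift0.
left; apply: head_lexlt; rewrite {1}/shift {1}/zeros_GR add0n kn alphaGR0 /=.
by lia.
Qed.

Lemma zeros_GR_inj : injective zeros_GR.
Proof.
have h m n : zeros_GR m = zeros_GR n -> (n <= m)%N.
  move=> e; rewrite leqNgt; apply/negP => mn.
  have := congr1 (fun v : dseq M => v m : nat) e.
  by rewrite /zeros_GR ltnn mn subnn alphaGR0 /=; lia.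
by move=> m n e; apply/eqP; rewrite eqn_leq !h.
Qed.

End GR.

(** * The threshold [alphaKL] *)

Section ThueMorse.

Lemma thue_morse_widen N n : (n <= N)%N ->
  thue_morse n = odd (\sum_(k < N) odd (n %/ 2 ^ k))%N.
Proof.
rewrite /thue_morse => /subnKC <-; elim: (N - n)%N => [|d IHd].
  by rewrite addn0.
rewrite addnS big_ord_recr /= IHd; congr odd.
rewrite divn_small ?addn0 //; apply: leq_ltn_trans (leq_addr d n) _.
exact: ltn_expl.
Qed.

Lemma thue_morse_half n : thue_morse n = thue_morse n./2 (+) odd n.
Proof.
rewrite (@thue_morse_widen n.+1 n) // (@thue_morse_widen n n./2); last by lia.
rewrite big_ord_recl /= divn1 oddD oddb addbC; congr (odd _ (+) _).
by apply: eq_bigr => i _; rewrite /bump /= add1n expnS divnMA divn2.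
Qed.

Lemma thue_morse0 : thue_morse 0 = false.
Proof. by rewrite /thue_morse big_ord0. Qed.

(** Adding [2 ^ n] puts one more 1 in the binary expansion of [i]. *)
Lemma thue_morse_pow2D n i : (i < 2 ^ n)%N ->
  thue_morse (2 ^ n + i) = ~~ thue_morse i.
Proof.
elim: n i => [|n IHn] i.
  rewrite expn0 ltnS leqn0 => /eqP->.
  by rewrite addn0 thue_morse_half /= thue_morse0.
rewrite expnS mul2n => i_n; rewrite thue_morse_half [in RHS]thue_morse_half.
rewrite halfD oddD odd_double /= doubleK IHn; last by lia.
by rewrite addNb.
Qed.

Lemma thue_morse_pow2 n : thue_morse (2 ^ n).
Proof. by rewrite -[(2 ^ n)%N]addn0 thue_morse_pow2D ?expn_gt0 // thue_morse0. Qed.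

End ThueMorse.

(** * Comparisons decided on a prefix *)

Section FiniteComparison.
Context {M : nat}.
Implicit Types s t u : dseq M.

(** Bounding the position of the first difference gives strict inequality a size, on which the
    argument below [alphaKL] proceeds by induction. *)
Definition lexltn N s t : Prop :=
  exists2 n, (n < N)%N & (forall i, (i < n)%N -> s i = t i) /\ (s n < t n)%N.

Lemma lexltn1 s t : lexltn 1 s t -> (s 0 < t 0)%N.
Proof. by move=> [[|n] // _ [_]]. Qed.

Lemma lexltn_widen N N' s t : (N <= N')%N -> lexltn N s t -> lexltn N' s t.
Proof. by move=> NN' [n nN h]; exists n => //; apply: leq_trans NN'. Qed.

Lemma lexltP s t : lexlt s t <-> exists N, lexltn N s t.
Proof. by split=> [[n h]|[N [n _ h]]]; [exists n.+1; exists n | exists n]. Qed.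

Lemma lexlt_lexltn N s t u : lexlt s t -> lexltn N t u -> lexltn N s u.
Proof.
move=> [m [em lm]] [n nN [en ln]]; case: (ltngtP m n) => [lt|lt|e].
- exists m; rewrite ?(ltn_trans lt) //; split; last by rewrite -en.
  by move=> i im; rewrite em // en // (ltn_trans im).
- exists n => //; split; last by rewrite em.
  by move=> i im; rewrite em ?en // (ltn_trans im).
- subst n; exists m => //; split; last exact: ltn_trans ln.
  by move=> i im; rewrite em ?en.
Qed.

End FiniteComparison.

(** * Eventually periodic sequences *)

Section EventuallyPeriodic.
Context {M : nat}.
Implicit Types s : dseq M.

Definition eventually_periodic s := exists N p, (0 < p)%N /\
  forall i, (N <= i)%N -> s (i + p)%N = s i.

Lemma eventually_periodic_shift n s :
  eventually_periodic (shift n s) -> eventually_periodic s.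
Proof.
move=> [N [p [p0 h]]]; exists (N + n)%N, p; split=> // i i_N.
have := h (i - n)%N; rewrite /shift addnAC subnK; last by lia.
by apply; lia.
Qed.

Lemma eventually_periodic_reflect s :
  eventually_periodic (reflect_seq s) -> eventually_periodic s.
Proof.
move=> [N [p [p0 h]]]; exists N, p; split=> // i i_N.
exact: rev_ord_inj (h i i_N).
Qed.

(** Such a sequence is coded by two finite words, its preperiod and its period. *)
Lemma countable_evper : countable [set s | eventually_periodic s].
Proof.
pose F (x : seq 'I_M.+1 * seq 'I_M.+1) : dseq M := fun i =>
  if (i < size x.1)%N then nth ord0 x.1 i
  else nth ord0 x.2 ((i - size x.1) %% size x.2).
apply: (sub_countable (B := range F)); last first.
  exact: sub_countable (card_image_le _ _) (countableP _).
apply: subset_card_le => s [N [p [p0 h]]].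
exists (mkseq s N, mkseq (shift N s) p) => //; apply/funext => i.
rewrite /F /= !size_mkseq; case: ltnP => iN; first by rewrite nth_mkseq.
rewrite nth_mkseq ?ltn_pmod // /shift -[in RHS](subnK iN).
set d := (i - N)%N; rewrite [in RHS](divn_eq d p).
elim: (d %/ p)%N => [|q IHq] //.
by rewrite IHq mulSn -[LHS](h _ _) ?leq_addl //; congr s; lia.
Qed.

End EventuallyPeriodic.

(** * Self-similarity of [alphaKL] and rigidity below it *)

Section KL.
Context {M : nat} (hM : (1 <= M)%N).
Implicit Types (s t u v : dseq M) (z : nat -> bool).
Local Notation KL := (alphaKL M).

(** The coding that turns Thue-Morse into [alphaKL], for arbitrary bits: complementing bits reflects
    digits, whatever the parity of [M]. *)
Definition bin_seq z : dseq M := fun i =>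
  if odd M then inord (M.+1./2.-1 + z i.+1)%N
  else inord (M./2 + z i.+1 - z i)%N.

Lemma alphaKLE : KL = bin_seq thue_morse.
Proof. by []. Qed.

Lemma bin_seqE z i : bin_seq z i =
  (if odd M then M.+1./2.-1 + z i.+1 else M./2 + z i.+1 - z i)%N :> nat.
Proof.
rewrite /bin_seq; case: ifP => oM; rewrite inordK //.
  by case: (z _); lia.
by case: (z _); case: (z _); lia.
Qed.

Lemma bin_seq_reflect z : reflect_seq (bin_seq z) = bin_seq (fun i => ~~ z i).
Proof.
apply/funext => i; apply: val_inj; rewrite -[LHS]/(nat_of_ord _) reflect_seqE /=.
by rewrite !bin_seqE; case: ifP => oM; case: (z i); case: (z i.+1) => /=; lia.
Qed.

Lemma bin_seq_shift n z : shift n (bin_seq z) = bin_seq (shift n z).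
Proof. by []. Qed.

(** Leaves at most one digit strictly between [M - KL 0] and [KL 0]. *)
Lemma alphaKL0 : (2 * KL 0%N <= M + 2)%N.
Proof.
rewrite bin_seqE thue_morse0 (thue_morse_pow2 0); case: ifP => oM; lia.
Qed.

(** The index [i = 2 ^ n - 1] is excluded: the digit there involves the bit at [2 ^ n.+1]. *)
Lemma alphaKL_double n i : (i.+1 < 2 ^ n)%N -> KL (2 ^ n + i)%N = (M - KL i)%N :> nat.
Proof.
move=> h; rewrite -reflect_seqE bin_seq_reflect !bin_seqE -addnS.
by rewrite !thue_morse_pow2D // ltnW.
Qed.

Lemma alphaKL_last n : KL (2 ^ n).-1 = 
  (if odd M then M.+1./2 else M./2.+1 - thue_morse (2 ^ n).-1)%N :> nat.
Proof.
have n0 : (0 < 2 ^ n)%N by rewrite expn_gt0.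
by rewrite bin_seqE prednK // thue_morse_pow2 /=; case: ifP => oM; lia.
Qed.

Lemma alphaKL_last_gt0 n : (0 < KL (2 ^ n).-1)%N.
Proof. by rewrite alphaKL_last; case: ifP => oM; last case: (thue_morse _) => /=; lia. Qed.

(** The bits at [2 ^ n] and [2 ^ n.+1] are both 1 instead of complementary, whence the extra
    unit. *)
Lemma alphaKL_last_double n :
  KL (2 ^ n + (2 ^ n).-1)%N = (M - KL (2 ^ n).-1).+1 :> nat.
Proof.
have n0 : (0 < 2 ^ n)%N by rewrite expn_gt0.
rewrite alphaKL_last.
have -> : (2 ^ n + (2 ^ n).-1)%N = (2 ^ n.+1).-1 by rewrite expnS; lia.
rewrite alphaKL_last.
have -> : (2 ^ n.+1).-1 = (2 ^ n + (2 ^ n).-1)%N by rewrite expnS; lia.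
rewrite thue_morse_pow2D; last by lia.
by case: ifP => oM; last case: (thue_morse _) => /=; lia.
Qed.

Lemma lexltn_half n u : lexltn (2 ^ n.+1) u KL -> ~ lexltn (2 ^ n) u KL ->
  forall j, (j < 2 ^ n)%N -> u j = KL j.
Proof.
move=> [i _ [e l]] h j jn; apply: (e); apply: leq_trans jn _.
by rewrite leqNgt; apply/negP => i_n; apply: h; exists i; last by split.
Qed.

(* The prefix of [KL] of length [2 ^ n.+1] is [w] followed by the reflection of
   [w] with its last digit increased, where [w] is the prefix of length [2 ^ n].
   If [u] begins with [w], the two bounds leave the reflection of [w] as the
   only possible next block. *)
Lemma below_KL_block n u :
  below (lexltn (2 ^ n.+1)) KL u -> lexltn (2 ^ n.+1) u KL ->
  (forall j, (j < 2 ^ n)%N -> u j = KL j) ->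
  let v := reflect_seq (shift (2 ^ n) u) in
  lexltn (2 ^ n.+1) v KL /\ (forall j, (j < 2 ^ n)%N -> v j = KL j).
Proof.
move=> bu [i iN [ei li]] eu v.
have n0 : (0 < 2 ^ n)%N by rewrite expn_gt0.
have hv : lexltn (2 ^ n.+1) v KL.
  have [_ +] := bu (2 ^ n).-1; rewrite prednK //; apply.
  by rewrite eu ?alphaKL_last_gt0 //; lia.
split=> //; have := hv => -[i' _ [ei' li']].
have iN' : (2 ^ n <= i)%N.
  rewrite leqNgt; apply/negP => lt; move: li; rewrite eu // ltnn //.
have vE j : v j = (M - u (2 ^ n + j)%N)%N :> nat by rewrite reflect_seqE /shift addnC.
pose k := (i - 2 ^ n)%N; have ik : i = (2 ^ n + k)%N by rewrite subnKC.
rewrite expnS in iN.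
have uM j := ltn_ord (u j); have KM j := ltn_ord (KL j).
have ev j : (j < k)%N -> v j = KL j.
  move=> jk; apply: val_inj; rewrite -[LHS]/(nat_of_ord _) vE ei; last by lia.
  by rewrite alphaKL_double; [have := KM j; rewrite /=; lia | lia].
have i'k : (k <= i')%N.
  by rewrite leqNgt; apply/negP => lt; move: li'; rewrite ev // ltnn.
(* Here [v] agrees with [KL] before [k]. If [k] is not the last index of the block, [v k] exceeds
   [KL k], against [hv]; at the last index the extra unit leaves [KL k <= v k], so [v] and [KL]
   first differ after the block. *)
have [kn|kn] := ltnP k.+1 (2 ^ n)%N.
  have lk : (KL k < v k)%N.
    move: li; rewrite ik alphaKL_double // vE; have := uM (2 ^ n + k)%N.
    by have := KM k; lia.
  have [lt|e] : (k < i')%N \/ k = i' by lia.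
    by rewrite ei' // ltnn in lk.
  by move: li'; rewrite -e; lia.
have ek : k = (2 ^ n).-1 by lia.
have lk : (KL k <= v k)%N.
  move: li; rewrite ik ek alphaKL_last_double // vE; have := uM (2 ^ n + (2 ^ n).-1)%N.
  by have := KM (2 ^ n).-1; lia.
move=> j jn; apply: ei'; suff : k <> i' by lia.
by move=> e; move: li'; rewrite -e; lia.
Qed.

(** Repeated use of [below_KL_block] shows that successive blocks of length [2 ^ n] reflect each
    other. *)
Lemma below_KL_periodic n u :
  below (lexltn (2 ^ n.+1)) KL u -> lexltn (2 ^ n.+1) u KL ->
  (forall j, (j < 2 ^ n)%N -> u j = KL j) -> eventually_periodic u.
Proof.
have n0 : (0 < 2 ^ n)%N by rewrite expn_gt0.
move=> bu lu eu; suff h i : u (i + 2 ^ n)%N = rev_ord (u i).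
  exists 0%N, (2 ^ n.+1)%N; split=> [|i _]; first by rewrite expn_gt0.
  by rewrite expnS mul2n -addnn addnA !h rev_ordK.
have [m] := ubnP i; elim: m i u bu lu eu => // m IHm i u bu lu eu im.
have [lv ev] := below_KL_block bu lu eu.
have [i_n|ni] := ltnP i (2 ^ n).
  by rewrite (eu i) // -ev // /reflect_seq rev_ordK.
have bv := below_reflect (below_shift (2 ^ n) bu).
have := IHm (i - 2 ^ n)%N _ bv lv ev; rewrite /reflect_seq /shift subnK //.
by move=> /(_ ltac:(lia)) /rev_ord_inj.
Qed.

(** Only first digits are compared. After a digit other than [M] and a later one other than 0, all
    digits lie strictly between [M - KL 0] and [KL 0]; in every case the sequence is eventually
    constant. *)
Lemma below_KL_evper0 s : below (lexltn (2 ^ 0)) KL s -> eventually_periodic s.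
Proof.
move=> b; have K0 := alphaKL0.
have up n : (s n < M)%N -> (s n.+1 < KL 0)%N.
  by have [h _] := b n => /h /lexltn1.
have dn n : (0 < s n)%N -> (M - KL 0 < s n.+1)%N.
  have [_ h] := b n => /h /lexltn1.
  by rewrite reflect_seqE /shift add0n; have := ltn_ord (s n.+1); lia.
have const c N : (forall i, (N <= i)%N -> s i = c) -> eventually_periodic s.
  by move=> h; exists N, 1%N; split=> // i iN; rewrite !h //; lia.
have [hM'|/existsNP[n nM]] := pselect (forall n, s n = M :> nat).
  by apply: (const ord_max 0%N) => i _; apply: val_inj; rewrite /= hM'.
have KM := ltn_ord (KL 0).
have up' i : (n < i)%N -> (s i < KL 0)%N.
  elim: i => // i IHi; rewrite ltnS leq_eqVlt => /orP[/eqP<-|/IHi h].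
    by apply: up; have := ltn_ord (s n); lia.
  by apply: up; lia.
have [hz|/existsNP[m /not_implyP[nm mz]]] :=
    pselect (forall m, (n < m)%N -> s m = 0%N :> nat).
  by apply: (const ord0 n.+1) => i /hz h; apply: val_inj.
have dn' i : (m < i)%N -> (M - KL 0 < s i)%N.
  elim: i => // i IHi; rewrite ltnS leq_eqVlt => /orP[/eqP<-|/IHi h].
    by apply: dn; lia.
  by apply: dn; lia.
apply: (const (s m.+1) m.+1) => i mi; apply: val_inj => /=.
have := dn' _ mi; have := dn' _ (ltnSn m); have := up' i; have := up' m.+1.
lia.
Qed.

(** Either the bound improves to [2 ^ n], or some tail, possibly reflected, begins with the first
    [2 ^ n] digits of [KL] and is periodic. *)
Lemma below_KL_evper n s : below (lexltn (2 ^ n)) KL s -> eventually_periodic s.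
Proof.
elim: n s => [|n IHn] s b; first exact: below_KL_evper0.
have [/IHn //|/existsNP[m]] := pselect (below (lexltn (2 ^ n)) KL s).
have [b1 b2] := b m.
move=> /not_andP[|] /not_implyP[h nl]; apply: (@eventually_periodic_shift _ m.+1).
  apply: (below_KL_periodic _ (b1 h)); first exact: below_shift.
  exact: lexltn_half (b1 h) nl.
apply: eventually_periodic_reflect.
apply: (below_KL_periodic _ (b2 h)); first exact/below_reflect/below_shift.
exact: lexltn_half (b2 h) nl.
Qed.

End KL.

(** * A Cantor set of admissible sequences *)

Section Coding.
Implicit Types (z w e : nat -> bool).

Definition binlt z w :=
  exists n, (forall i, (i < n)%N -> z i = w i) /\ (z n < w n)%N.

Definition theta z : nat -> bool := fun n => z n./2 (+) odd n.

Lemma theta_binlt z w : binlt z w -> binlt (theta z) (theta w).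
Proof.
move=> [n [h l]]; exists n.*2; split=> [i i_n|].
  by rewrite /theta h //; lia.
by rewrite /theta doubleK odd_double !addbF.
Qed.

Lemma theta_thue_morse : theta thue_morse = thue_morse.
Proof. by apply/funext => n; rewrite [RHS]thue_morse_half. Qed.

Lemma theta_pair z m : theta z m.*2.+1 = ~~ theta z m.*2.
Proof. by rewrite /theta /= uphalf_double doubleK odd_double addbT addbF. Qed.

Lemma theta_shift z m : shift m.*2 (theta z) = theta (shift m z).
Proof.
by apply/funext => i; rewrite /theta /shift halfD oddD odd_double andbF doubleK addbF.
Qed.

(** Two of the three positions form a pair [2m, 2m+1], whose bits differ. *)
Lemma theta_no_111 z n : theta z n -> theta z n.+1 -> theta z n.+2 = false.
Proof.
have := odd_double_half n; case: (odd n) => [|] <-.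
  by rewrite add1n -doubleS (theta_pair z (half n).+1); case: (theta z (half n).+1.*2).
by rewrite add0n theta_pair; case: (theta z _).
Qed.

(** [k] is fuel; [n + 1] units suffice because the recursive index is less than [n]. The last
    [false] is a default. *)
Fixpoint code_rec (k : nat) e (n : nat) : bool :=
  if k is k'.+1 then
    match n./2 with
    | 0 => false
    | 1 => e 0%N
    | m.+2 => code_rec k' (shift 1 e) m
    end (+) odd n
  else false.

(* [code e] is the image under the Thue--Morse morphism [0 -> 01], [1 -> 10] of
   the word [0 (e 0)] followed by [code (shift 1 e)]. *)
Definition code e : nat -> bool := fun n => code_rec n.+1 e n.

Definition pre2 (b : bool) z : nat -> bool :=
  fun n => match n with 0 => false | 1 => b | m.+2 => z m end.

Lemma code_rec_stable k e n : (n < k)%N -> code_rec k e n = code e n.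
Proof.
rewrite /code; have [N] := ubnP k; elim: N k n e => // N IHN [//|k] n e kN nk.
rewrite [LHS]/= [RHS]/=; congr (_ (+) _).
case en: n./2 => [//|[//|m]].
have mn : (m.+1 < n)%N by lia.
by rewrite !(IHN _ m) //; lia.
Qed.

Lemma codeE e : code e = theta (pre2 (e 0%N) (code (shift 1 e))).
Proof.
apply/funext => n; rewrite {1}/code /theta /=; congr (_ (+) _).
case en: n./2 => [//|[//|m]] /=; apply: code_rec_stable; lia.
Qed.

Lemma code0 e : code e 0 = false. Proof. by rewrite codeE. Qed.
(** Even positions undo [theta]: position 2 holds the free bit, positions [2 (m + 2)] the code of
    the remaining bits. *)
Lemma code_inj : injective code.
Proof.
move=> e e' h; apply/funext => i.
elim: i e e' h => [|i IHi] e e' h.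
  by have := congr1 (fun z => z 2%N) h; rewrite (codeE e) (codeE e') /theta /= !addbF.
have {IHi} := IHi (shift 1 e) (shift 1 e'); rewrite /shift !addn1; apply.
apply/funext => m; have := congr1 (fun z => z m.+2.*2) h.
by rewrite (codeE e) (codeE e') /theta doubleK odd_double !addbF.
Qed.

Definition neg (c : bool) z : nat -> bool := fun i => z i (+) c.

Lemma theta_negc c z : neg c (theta z) = theta (neg c z).
Proof. by apply/funext => i; rewrite /neg /theta addbAC. Qed.

(* The case [c = true] is the mirror statement for [1]-tails. *)
Lemma code_binlt c n e : neg c (code e) n = false ->
  binlt (shift n (neg c (code e))) thue_morse.
Proof.
have [N] := ubnP n; elim: N n e => // N IHN n e nN.
have tm1 : thue_morse 1 by exact: (thue_morse_pow2 0).
have tm2 : thue_morse 2 by exact: (thue_morse_pow2 1).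
have lt1 z : z 0%N = false -> z 1%N = false -> binlt z thue_morse.
  move=> z0 z1; exists 1%N; rewrite z1 tm1; split=> // -[|//] _.
  by rewrite z0 thue_morse0.
have lt2 z : z 0%N = false -> z 2%N = false -> binlt z thue_morse.
  move=> z0 z2; case z1 : (z 1%N); last exact: lt1.
  exists 2%N; rewrite z2 tm2; split=> // -[|[|//]] _; first by rewrite z0 thue_morse0.
  by rewrite z1 tm1.
(* Thue-Morse begins with 011, so a sequence beginning with 0 but not with 011 is smaller. *)
have lt12 z : z 0%N = false -> ~~ (z 1%N && z 2%N) -> binlt z thue_morse.
  by move=> z0; rewrite negb_and => /orP[] /negbTE; [apply: lt1 | apply: lt2].
rewrite codeE theta_negc; set p := neg c _.
(* From an odd position, the second and third letters form a pair of [theta] and differ. From an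
   even one, [theta] can be removed, which halves the index. *)
have := odd_double_half n; set m := n./2; case: (odd n) => nE; rewrite -nE.
  rewrite add1n => h; apply: lt12 => //.
  by rewrite /shift add1n add2n -doubleS theta_pair; case: (theta p _).
rewrite add0n theta_shift => h; rewrite -theta_thue_morse; apply: theta_binlt.
move: h; rewrite {1}/theta doubleK odd_double addbF.
rewrite {nE}; have mn : (m <= n)%N by rewrite /m; lia.
(* For [m = 0] the first and third letters agree; for [m = 1] the second and third differ. *)
case: m mn => [|[|m]] mn h.
- apply: lt12 => //; rewrite shift0 /p /neg /=.
  by move: h; rewrite /p /neg /= => ->; rewrite andbF.
- apply: lt12 => //; rewrite /shift !addn1 /p /neg /=.
  by case: (c).
have -> : shift m.+2 p = shift m (neg c (code (shift 1 e))).
  by apply/funext => i; rewrite /shift /p /neg !addnS.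
by apply: IHN; [lia | exact: h].
Qed.

(** A tail starting with bit 1 already has a smaller first digit when [M] is even; when [M] is odd,
    two more bits 1 are excluded while [alphaKL] starts with two maximal digits of the coding. *)
Lemma code_bin_lt {M : nat} (hM : (1 <= M)%N) c n e :
  lexlt (bin_seq (shift n (neg c (code e)))) (alphaKL M).
Proof.
have tm1 : thue_morse 1 by exact: (thue_morse_pow2 0).
have tm2 : thue_morse 2 by exact: (thue_morse_pow2 1).
rewrite alphaKLE; set z := neg c (code e).
case zn : (z n).
  case oM : (odd M); last first.
    apply: head_lexlt; rewrite !bin_seqE // oM /shift zn tm1 thue_morse0.
    by case: (z _) => /=; lia.
  case zn1 : (z n.+1); last first.
    apply: head_lexlt; rewrite !bin_seqE // oM /shift add1n zn1 tm1.
    lia.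
  have zn2 : z n.+2 = false.
    by move: zn zn1; rewrite /z codeE theta_negc => a b; apply: theta_no_111.
  exists 1%N; split=> [[|//] _|]; last first.
    rewrite !bin_seqE // oM /shift add2n zn2 tm2; lia.
  by apply: val_inj; rewrite -[LHS]/(nat_of_ord _) -[RHS]/(nat_of_ord _)
    !bin_seqE // oM /shift add1n zn1 tm1.
(* Digit [i] reads bit [i + 1], so bits first differing at [w + 1] give digits first differing at
   [w]. *)
have [[|w] [h l]] := code_binlt zn; rewrite -/z in h l.
  by rewrite thue_morse0 ltn0 in l.
exists w; split=> [i iw|].
  apply: val_inj; rewrite -[LHS]/(nat_of_ord _) -[RHS]/(nat_of_ord _).
  by rewrite !bin_seqE // !h //; lia.
rewrite !bin_seqE // (h w) //; move: l.
case: (shift n z w.+1); case: (thue_morse w.+1) => // _.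
by case: ifP => oM; case: (thue_morse w) => /=; lia.
Qed.

Lemma code_below {M : nat} (hM : (1 <= M)%N) e :
  below lexlt (alphaKL M) (bin_seq (code e)).
Proof.
have eF : neg false (code e) = code e by apply/funext => i; rewrite /neg addbF.
have eT : neg true (code e) = fun i => ~~ code e i.
  by apply/funext => i; rewrite /neg addbT.
move=> n; split=> _.
  by rewrite bin_seq_shift -eF; apply: code_bin_lt.
rewrite reflect_shift bin_seq_reflect // bin_seq_shift -eT.
exact: code_bin_lt.
Qed.

(** For even [M] the digits record differences of successive bits, so the first bit is
    prescribed. *)
Lemma bin_seq_inj {M : nat} (hM : (1 <= M)%N) z w :
  z 0%N = w 0%N -> bin_seq z = bin_seq w :> dseq M -> z = w.
Proof.
move=> h0 h; apply/funext; elim=> [//|i IHi].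
have := congr1 (fun v : dseq M => v i : nat) h; rewrite !bin_seqE // IHi.
by case: ifP => oM; case: (z _); case: (w _) => //=; case: (w i) => //=; lia.
Qed.

End Coding.

(** * Admissibility below and above a threshold *)

Section Bridges.
Context {R : realType} {M : nat} (S : alphabet_base R M) (hS : regular S).
Implicit Types (s t u K : dseq M) (r : dseq M -> dseq M -> Prop).
Local Notation S' := (reflect_sys S).

Lemma univoque_seq_below r K s :
  (forall j, (j < M)%N -> (forall u, lexlt u (alpha S j) -> r u K) /\
    (forall u, lexlt u (alpha S' j) -> r u K)) ->
  univoque_seq S s -> below r K s.
Proof.
move=> h /(univoque_seqP hS) [us us'] n; split=> sn.
  by apply: (h _ sn).1; apply: us.
have rn : (reflect_seq s n < M)%N.
  by rewrite reflect_seqE; have := ltn_ord (s n); lia.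
by rewrite reflect_shift; apply: (h _ rn).2; apply: us'.
Qed.

Lemma below_univoque_seq r K s :
  (forall j, (j < M)%N -> (forall u, r u K -> lexlt u (alpha S j)) /\
    (forall u, r u K -> lexlt u (alpha S' j))) ->
  below r K s -> univoque_seq S s.
Proof.
move=> h b; apply/(univoque_seqP hS); split=> n sn; have [b1 b2] := b n.
  by apply: (h _ sn).1; apply: b1.
rewrite -reflect_shift; apply: (h _ sn).2; apply: b2.
by move: sn; rewrite reflect_seqE; lia.
Qed.

End Bridges.

Section Constant.
Context {R : realType} {M : nat} (S : alphabet_base R M) (hS : regular S).

Lemma upper_admissible_cseq0 : upper_admissible S (cseq ord0).
Proof.
move=> n nM; have [ga _] := alpha_spec hS nM.
apply: (quasi_greedy_lt ga); rewrite (_ : shift _ _ = cseq ord0) // pi_val0 //.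
by have [] := ga 0%N; rewrite shift0.
Qed.

Lemma upper_admissible_cseqM : upper_admissible S (cseq ord_max).
Proof. by move=> n; rewrite /= ltnn. Qed.

End Constant.

Lemma univoque_seq_cseq {R : realType} {M : nat} (S : alphabet_base R M) :
  regular S -> [set cseq ord0; cseq ord_max] `<=` univoque_seq S.
Proof.
move=> hS _ [] ->; apply/(univoque_seqP hS).
  rewrite reflect_cseq rev_ord0; split; first exact: upper_admissible_cseq0.
  exact: upper_admissible_cseqM.
rewrite reflect_cseq rev_ord_max; split; first exact: upper_admissible_cseqM.
exact/upper_admissible_cseq0/reflect_regular.
Qed.

Lemma lexltn_unif {M : nat} (a b : nat -> dseq M) (K : dseq M) m :
  (forall j, (j < m)%N -> lexlt (a j) K /\ lexlt (b j) K) ->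
  exists N, forall j, (j < m)%N -> lexltn N (a j) K /\ lexltn N (b j) K.
Proof.
elim: m => [|m IHm] h; first by exists 0%N.
have [j jm|N hN] := IHm; first by apply: h; rewrite ltnS ltnW.
have [/lexltP[N1 h1] /lexltP[N2 h2]] := h m (ltnSn m).
exists (maxn N (maxn N1 N2)) => j; rewrite ltnS leq_eqVlt => /orP[/eqP->|/hN[]].
  by split; [move: h1|move: h2]; apply: lexltn_widen; lia.
by move=> h3 h4; split; [move: h3|move: h4]; apply: lexltn_widen; lia.
Qed.

(** * Cardinality comparisons and the four cases *)

Lemma inj_image_card_le {T U : Type} (f : T -> U) (A : set U) :
  injective f -> (forall x, A (f x)) -> ([set: T] #<= A)%card.
Proof.
move=> fI fA; apply: (@card_le_trans _ _ _ (f @` [set: T])); last first.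
  by apply: subset_card_le => _ [x _ <-].
have := inj_card_eq (A := [set: T]) (f := f) (in2W fI).
by rewrite card_eq_le => /andP[].
Qed.

(** Injects the reals into bit sequences through the enumerated rationals below [x]. *)
Definition dedekind_cut {R : realType} (x : R) : nat -> bool :=
  fun n => if unpickle n is Some q then ratr (q : rat) < x else false.

Lemma dedekind_cut_inj {R : realType} : injective (@dedekind_cut R).
Proof.
have h (x y : R) : dedekind_cut x = dedekind_cut y -> x <= y.
  move=> e; rewrite leNgt; apply/negP => /rat_in_itvoo [q].
  rewrite in_itv /= => /andP[yq qx].
  have := congr1 (fun z => z (pickle q)) e.
  by rewrite /dedekind_cut pickleK qx => /esym; rewrite ltNge (ltW yq).
by move=> x y e; apply/eqP; rewrite eq_le !h.
Qed.

Lemma univoque_seq_card_le {R : realType} {M : nat} (S : alphabet_base R M) :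
  (univoque_seq S #<= [set: R])%card.
Proof.
apply/pcard_injP; exists (pi_val S) => s t /set_mem [_ [u [_ hu]]] _ e.
by rewrite -(hu s) // -(hu t).
Qed.

Theorem theorem1p5 (R : realType) (M : nat) (hM : (1 <= M)%N)
    (S : alphabet_base R M) (hS : regular S) :
  [/\ (forall j : nat, (j < M)%N ->
         lexle (alpha S j) (alphaGR M) /\
         lexle (reflect_seq (alphaGR M)) (gamma S (M - j)%N)) ->
      univoque_seq S = [set cseq ord0; cseq ord_max],
      (forall j : nat, (j < M)%N ->
         lexlt (alphaGR M) (alpha S j) /\
         lexlt (gamma S (M - j)%N) (reflect_seq (alphaGR M))) ->
      infinite_set (univoque_seq S),
      (forall j : nat, (j < M)%N ->
         lexlt (alpha S j) (alphaKL M) /\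
         lexlt (reflect_seq (alphaKL M)) (gamma S (M - j)%N)) ->
      countable (univoque_seq S)
    & (forall j : nat, (j < M)%N ->
         lexle (alphaKL M) (alpha S j) /\
         lexle (gamma S (M - j)%N) (reflect_seq (alphaKL M))) ->
      (univoque_seq S #= [set: R])%card].
Proof.
split=> h.
- apply/seteqP; split=> [s us|]; last exact: univoque_seq_cseq.
  apply: (below_GR hM); apply: (univoque_seq_below hS) us => j jM.
  have [h1] := h j jM; rewrite gamma_reflect // lexle_reflect => h2.
  by split=> u hu; apply: lexlt_le_trans hu _.
- apply/infiniteP/(inj_image_card_le (zeros_GR_inj hM)) => n.
  apply: (below_univoque_seq hS) (zeros_GR_below hM n) => j jM.
  have [h1] := h j jM; rewrite gamma_reflect // lexlt_reflect => h2.
  by split=> u hu; apply: lexle_lt_trans hu _.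
- have [j jM|N hN] := @lexltn_unif _ (alpha S) (alpha (reflect_sys S)) (alphaKL M) M.
    have [h1] := h j jM; rewrite gamma_reflect // lexlt_reflect => h2.
    by split.
  apply: (sub_countable (B := [set s : dseq M | eventually_periodic s])); last exact: countable_evper.
  apply: subset_card_le => s us; apply: (below_KL_evper hM (n := N)).
  apply: (univoque_seq_below hS) us => j jM; have [h1 h2] := hN j jM.
  (* The induction for [alphaKL] runs over prefix lengths [2 ^ N], so the common bound [N] is
     enlarged to such a length. *)
  have NN : (N <= 2 ^ N)%N by apply: ltnW; apply: ltn_expl.
  by split=> u /lexlt_lexltn hu; apply/(lexltn_widen NN)/hu.
(* The value map gives the upper bound; the cuts, coded as admissible sequences, embed the reals. *)
- rewrite card_eq_le univoque_seq_card_le /=.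
  apply: (inj_image_card_le (f := fun x : R => bin_seq (code (dedekind_cut x)))).
    move=> x y /(bin_seq_inj hM); rewrite !code0 => /(_ erefl).
    by move=> /code_inj /dedekind_cut_inj.
  move=> x; apply: (below_univoque_seq hS) (code_below hM _) => j jM.
  have [h1] := h j jM; rewrite gamma_reflect // lexle_reflect => h2.
  by split=> u hu; apply: lexlt_le_trans hu _.
Qed.
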